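(* Let $\sigma=12\cdots(a-1)(a+1)a(a+2)(a+3)\cdots m$ where $m\geq5$ and $2\leq a\leq m-2$, let $i=\min(a,m-a)$, and let $z=x/(1-t)$. Then (a) \[ \sum_{n=0}^{\infty}\frac{A_{\sigma,n}^{\mathrm{ides}}(s,t)}{(1-t)^{n+1}}x^{n}=\sum_{n=0}^{\infty}\Bigg(\frac{tx}{(1-t)^{2}}+\frac{(s-1)t^{2}z^{m}}{(1-t)(1-(s-1)t\sum_{l=1}^{i}z^{m-l})}\Bigg)^{*\langle n\rangle} \] and (b) \[ \sum_{n=0}^{\infty}\frac{A_{\sigma,n}^{\mathrm{ides}}(t)}{(1-t)^{n+1}}x^{n}=\sum_{n=0}^{\infty}\Bigg(\frac{tx}{(1-t)^{2}}-\frac{t^{2}z^{m}}{(1-t)(1+t\sum_{l=1}^{i}z^{m-l})}\Bigg)^{*\langle n\rangle}. \]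
   Context: $\mathfrak{S}_n$ is the set of permutations of $[n]$ in one-line notation ($\mathfrak{S}_0$ = empty permutation). The pattern $\sigma\in\mathfrak{S}_m$ is the permutation obtained from $12\cdots m$ by swapping the adjacent letters $a$ and $a+1$. $\operatorname{std}$ of a sequence of distinct integers replaces its letters by $1,2,\dots$ in order of size. For $\pi\in\mathfrak{S}_n$, $\operatorname{occ}_\sigma(\pi)$ is the number of $j\in[n-m+1]$ with $\operatorname{std}(\pi_j\cdots\pi_{j+m-1})=\sigma$. $\operatorname{des}(\pi)$ is the number of $j\in[n-1]$ with $\pi_j>\pi_{j+1}$, and $\operatorname{ides}(\pi)=\operatorname{des}(\pi^{-1})$. $A_{\sigma,n}^{\mathrm{ides}}(s,t)=\sum_{\pi\in\mathfrak{S}_n}s^{\operatorname{occ}_\sigma(\pi)}t^{\operatorname{ides}(\pi)+1}$ for $n\ge1$, $=1$ for $n=0$, and $A_{\sigma,n}^{\mathrm{ides}}(t)=A_{\sigma,n}^{\mathrm{ides}}(0,t)$. The right sides are computed in formal power series with ordinary multiplication in $s,x$ and the Hadamard product in $t$: $(\sum_n a_nt^n)*(\sum_n b_nt^n)=\sum_n a_nb_nt^n$; $f^{*\langle n\rangle}$ is the $n$-fold Hadamard product, $f^{*\langle0\rangle}=1/(1-t)$. Other expressions use ordinary multiplication. *)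

(* Defs.v *)
From HB Require Import structures.
From mathcomp Require Import all_boot all_order all_algebra all_fingroup.
From mathcomp Require Import boolp.
Set Implicit Arguments.
Unset Strict Implicit.
Unset Printing Implicit Defensive.
Import GRing.Theory.
Local Open Scope ring_scope.

Record fps (R : Type) := Fps { fcoef : nat -> R }.

HB.instance Definition _ (R : Type) := gen_eqMixin (fps R).
HB.instance Definition _ (R : Type) := gen_choiceMixin (fps R).

Lemma fpsP (R : Type) (f g : fps R) :
  (forall k, fcoef f k = fcoef g k) -> f = g.
Proof. by case: f g => [f] [g] /= fg; congr Fps; apply: funext. Qed.

Section FpsZmod.
Variable R : zmodType.
Implicit Types f g h : fps R.

Definition fps0 : fps R := Fps (fun=> 0).
Definition fps_opp f := Fps (fun k => - fcoef f k).
Definition fps_add f g := Fps (fun k => fcoef f k + fcoef g k).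

Fact fps_addA : associative fps_add.
Proof. by move=> f g h; apply: fpsP => k /=; rewrite addrA. Qed.
Fact fps_addC : commutative fps_add.
Proof. by move=> f g; apply: fpsP => k /=; rewrite addrC. Qed.
Fact fps_add0 : left_id fps0 fps_add.
Proof. by move=> f; apply: fpsP => k /=; rewrite add0r. Qed.
Fact fps_addN : left_inverse fps0 fps_opp fps_add.
Proof. by move=> f; apply: fpsP => k /=; rewrite addNr. Qed.

HB.instance Definition _ :=
  GRing.isZmodule.Build (fps R) fps_addA fps_addC fps_add0 fps_addN.

End FpsZmod.

Section FpsRing.
Variable R : comNzRingType.
Implicit Types f g h : fps R.

Definition fpsC (c : R) : fps R := Fps (fun k => if k == 0%N then c else 0).
Definition fpsX : fps R := Fps (fun k => (k == 1%N)%:R).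

Definition fps_mul f g :=
  Fps (fun k => \sum_(j < k.+1) fcoef f j * fcoef g (k - j)).

Definition fps_trunc n f : {poly R} := \poly_(i < n) fcoef f i.

Lemma coef_fps_mul_trunc n f g k : (k < n)%N ->
  fcoef (fps_mul f g) k = (fps_trunc n f * fps_trunc n g)`_k.
Proof.
move=> kn; rewrite coefM /=; apply: eq_bigr => j _; rewrite !coef_poly.
rewrite (leq_ltn_trans _ kn) ?(leq_ltn_trans (leq_subr _ _) kn) //.
by rewrite -ltnS.
Qed.

Fact fps_mulC : commutative fps_mul.
Proof.
by move=> f g; apply: fpsP => k; rewrite !(@coef_fps_mul_trunc k.+1) // mulrC.
Qed.

Fact fps_mulA : associative fps_mul.
Proof.
move=> f g h; apply: fpsP => k.
transitivity ((fps_trunc k.+1 f * (fps_trunc k.+1 g * fps_trunc k.+1 h))`_k).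
  rewrite coefM /=; apply: eq_bigr => j _; rewrite coef_poly ltn_ord.
  by congr (_ * _); rewrite -(@coef_fps_mul_trunc k.+1) // ltnS leq_subr.
rewrite mulrA coefM /=; apply: eq_bigr => j _.
rewrite -(@coef_fps_mul_trunc k.+1) ?ltn_ord //.
by congr (_ * _); rewrite coef_poly ltnS leq_subr.
Qed.

Fact fps_mul1 : left_id (fpsC 1) fps_mul.
Proof.
move=> f; apply: fpsP => k /=; rewrite big_ord_recl /= mul1r subn0 big1 ?addr0 //.
by move=> j _; rewrite mul0r.
Qed.

Fact fps_mulDl : left_distributive fps_mul (@fps_add R).
Proof.
move=> f g h; apply: fpsP => k /=; rewrite -big_split /=.
by apply: eq_bigr => j _; rewrite mulrDl.
Qed.

Fact fps_1neq0 : fpsC 1 != 0 :> fps R.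
Proof.
by apply/eqP => /(congr1 (fun f => fcoef f 0)) /eqP /=; rewrite oner_eq0.
Qed.

HB.instance Definition _ := GRing.Zmodule_isComNzRing.Build (fps R)
  fps_mulA fps_mulC fps_mul1 fps_mulDl fps_1neq0.

Lemma fcoefD f g k : fcoef (f + g) k = fcoef f k + fcoef g k.
Proof. by []. Qed.
Lemma fcoefN f k : fcoef (- f) k = - fcoef f k.
Proof. by []. Qed.
Lemma fcoefM f g k :
  fcoef (f * g) k = \sum_(j < k.+1) fcoef f j * fcoef g (k - j).
Proof. by []. Qed.
Lemma fcoef1 k : fcoef (1 : fps R) k = (k == 0%N)%:R.
Proof. by rewrite /=; case: eqP. Qed.
Lemma fcoef_sum I (r : seq I) (P : pred I) (F : I -> fps R) k :
  fcoef (\sum_(i <- r | P i) F i) k = \sum_(i <- r | P i) fcoef (F i) k.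
Proof. by elim/big_rec2: _ => // i x y _ <-. Qed.

Lemma fcoef_fpsCM c f k : fcoef (fpsC c * f) k = c * fcoef f k.
Proof.
rewrite fcoefM big_ord_recl /= subn0 big1 ?addr0 // => j _.
by rewrite mul0r.
Qed.

Lemma fcoefX_small f n k : fcoef f 0 = 0 -> (k < n)%N -> fcoef (f ^+ n) k = 0.
Proof.
move=> f0; elim: n k => // n IHn k kn; rewrite exprS fcoefM.
rewrite big_ord_recl f0 mul0r add0r big1 // => j _.
rewrite IHn ?mulr0 //= /bump /=; case: k kn j => [|k] kn j; first by case: j.
by rewrite subSS (leq_ltn_trans (leq_subr _ _)).
Qed.

End FpsRing.

Section FpsUnitRing.
Variable R : comUnitRingType.
Implicit Types f g : fps R.

Definition fps_unit : {pred fps R} := fun f => fcoef f 0 \is a GRing.unit.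

(* Geometric series: if c is the constant coefficient of f and h := 1 - f / c,
   then 1 / f = (1 + h + h ^+ 2 + ...) / c, and h ^+ i only contributes to the
   coefficients of index at least i. *)
Definition fps_inv f : fps R :=
  if fps_unit f then
    let c' := (fcoef f 0)^-1 in
    Fps (fun k => c' * fcoef (\sum_(i < k.+1) (1 - fpsC c' * f) ^+ i) k)
  else f.

Fact fps_mulVr : {in fps_unit, left_inverse 1 fps_inv *%R}.
Proof.
move=> f uf; rewrite /fps_inv [fps_unit f]uf /=.
set c' := (fcoef f 0)^-1; set h := 1 - fpsC c' * f.
have h0 : fcoef h 0 = 0.
  by rewrite /h fcoefD fcoefN fcoef1 fcoef_fpsCM mulVr // subrr.
apply: fpsP => k.
transitivity (fcoef ((\sum_(i < k.+1) h ^+ i) * (fpsC c' * f)) k).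
  rewrite [_ * (_ * f)]mulrA [_ * fpsC c']mulrC [RHS]fcoefM [LHS]fcoefM.
  apply: eq_bigr => j _; congr (_ * _); rewrite fcoef_fpsCM; congr (_ * _).
  rewrite !fcoef_sum (big_ord_widen k.+1 (fun i => fcoef (h ^+ i) j)) //.
  rewrite big_mkcond /=; apply: eq_bigr => i _; case: ltnP => // ji.
  by rewrite fcoefX_small.
have -> : fpsC c' * f = - (h - 1) by rewrite /h opprB opprB addrC subrK.
by rewrite mulrN mulrC -subrX1 opprB fcoefD fcoefN fcoefX_small // subr0.
Qed.

Fact fps_unitPl f g : g * f = 1 -> fps_unit f.
Proof.
move=> /(congr1 (fun h => fcoef h 0)).
rewrite fcoefM big_ord1 fcoef1 => gf1; apply/unitrPr.
by exists (fcoef g 0); rewrite mulrC.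
Qed.

Fact fps_inv_out : {in [predC fps_unit], fps_inv =1 id}.
Proof. by move=> f /negPf nuf; rewrite /fps_inv [fps_unit f]nuf. Qed.

HB.instance Definition _ := GRing.ComNzRing_hasMulInverse.Build (fps R)
  fps_mulVr fps_unitPl fps_inv_out.

Lemma fps_unitE f : (f \is a GRing.unit) = (fcoef f 0 \is a GRing.unit).
Proof. by []. Qed.

End FpsUnitRing.

(* K[[x]][[t]]: the outer variable is t, so that the Hadamard product in t is
   the coefficientwise product over K[[x]]. *)
Definition fps_xt (K : comUnitRingType) : Type := fps (fps K).
HB.instance Definition _ (K : comUnitRingType) :=
  GRing.ComUnitRing.on (fps_xt K).

Section BivariateSeries.
Variable K : comUnitRingType.

Definition cst_xt (c : K) : fps_xt K := fpsC (fpsC c).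
Definition var_x : fps_xt K := fpsC (fpsX K).
Definition var_t : fps_xt K := fpsX (fps K).

(* Outside the units, f^-1 is f; the denominators 1 - t and 1 - t * g are units. *)
Lemma unit_subr_var_t (g : fps_xt K) : 1 - var_t * g \is a GRing.unit.
Proof.
by rewrite fps_unitE fcoefD fcoefN fcoefM big_ord1 /= mul0r subr0 unitr1.
Qed.

Definition hadamard (f g : fps_xt K) : fps_xt K :=
  Fps (fun j => fcoef f j * fcoef g j).

Definition hadamard_exp (f : fps_xt K) (n : nat) : fps_xt K :=
  iter n (hadamard f) (1 / (1 - var_t)).

(* Convergence of the series with terms u to S in the usual topology on formal
   power series: every coefficient of the partial sums is eventually equal to
   the coefficient of S. *)
Definition series_sum (u : nat -> fps_xt K) (S : fps_xt K) : Prop :=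
  forall j k : nat, exists N : nat, forall n : nat, (N <= n)%N ->
    fcoef (fcoef (\sum_(i < n) u i) j) k = fcoef (fcoef S j) k.

End BivariateSeries.

Arguments var_x {K}.
Arguments var_t {K}.

Definition one_line (n : nat) (p : 'S_n) : seq nat :=
  [seq (p i).+1 | i <- enum 'I_n].

(* In a sequence of distinct integers, the k-th smallest letter is the one for
   which exactly k letters are at most equal to it. *)
Definition std (w : seq nat) : seq nat :=
  [seq count (fun y => y <= x)%N w | x <- w].

(* The starting positions are 0, ..., n - m, where m is the size of sigma; there
   are none if n < m, as n.+1 - m is then 0. *)
Definition occ (sigma : seq nat) (n : nat) (p : 'S_n) : nat :=
  count (fun j => std (take (size sigma) (drop j (one_line p))) == sigma)
    (iota 0 (n.+1 - size sigma)).

Definition des (n : nat) (p : 'S_n) : nat :=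
  count (fun j => nth 0 (one_line p) j.+1 < nth 0 (one_line p) j)%N
    (iota 0 n.-1).

Definition ides (n : nat) (p : 'S_n) : nat := des (p^-1)%g.

Definition A_ides (R : comNzRingType) (sigma : seq nat) (n : nat) (s t : R) : R :=
  if n == 0%N then 1
  else \sum_(p : 'S_n) s ^+ occ sigma p * t ^+ (ides p).+1.

(* 1 2 ... (a-1) (a+1) a (a+2) (a+3) ... m *)
Definition swap_pattern (m a : nat) : seq nat :=
  iota 1 a.-1 ++ [:: a.+1; a] ++ iota a.+2 (m - a.+1).

(* Main.v *)
(* The coefficient of t^N in t^(d+1) / (1-t)^(n+1) is 'C(N+n-1-d, n) (for n > 0),
   the number of words of length n over an N-letter alphabet whose standardization
   is a given permutation with d inverse descents.  Hence the coefficient of t^N on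
   the left counts words w over N letters by s^occ(w) x^|w|, and the Hadamard
   powers on the right become ordinary powers, so that the claim is the
   Goulden-Jackson cluster theorem for words: the sum over words is the inverse of
   1 - N x - (cluster series at s - 1).

   Two occurrences of the pattern can overlap in at most i = min(a, m - a) letters,
   and then, since m >= 5, the relative order of all letters of a cluster is forced:
   a cluster of c occurrences is an increasing word in which c disjoint pairs of
   adjacent entries have been exchanged.  Its standardization has c inverse
   descents, and summing the resulting binomial coefficients gives the rational
   function of the statement. *)
From HB Require Import structures.
Require Import Defs.
From mathcomp Require Import all_boot all_order all_algebra all_fingroup.
From mathcomp Require Import zify ring boolp.
Set Implicit Arguments.
Unset Strict Implicit.
Unset Printing Implicit Defensive.
Import GRing.Theory.
Local Open Scope ring_scope.

(** * Words over a finite alphabet *)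

Fixpoint words (N n : nat) : seq (seq nat) :=
  if n is n'.+1 then [seq x :: w | x <- iota 0 N, w <- words N n'] else [:: [::]].

Lemma mem_words N n w : (w \in words N n) = (size w == n) && all (gtn N) w.
Proof.
elim: n w => [|n IHn] w; first by rewrite inE; case: w.
apply/allpairsP/idP => [[[x v] /= [Nx wv ->]]|].
  move: wv Nx; rewrite IHn /= eqSS mem_iota => /andP[-> ->].
  by rewrite andbT.
case: w => // x w /= /andP[sw /andP[Nx Nw]].
by exists (x, w); split; rewrite //= ?mem_iota // IHn Nw andbT.
Qed.

Lemma words_uniq N n : uniq (words N n).
Proof.
elim: n => //= n IHn; apply: allpairs_uniq; rewrite ?iota_uniq //.
by move=> [x v] [y w] _ _ /= [-> ->].
Qed.

Section BigWords.
Variable V : nmodType.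
Implicit Type F : seq nat -> V.

Lemma sum_words_cat N p q F :
  \sum_(w <- words N (p + q)) F w =
    \sum_(u <- words N p) \sum_(v <- words N q) F (u ++ v).
Proof.
elim: p F => [|p IHp] F; first by rewrite big_seq1.
rewrite addSn /= !big_allpairs_dep; apply: eq_bigr => x _.
by rewrite (IHp (fun w => F (x :: w))).
Qed.

Lemma reindex_words N n (h : seq nat -> seq nat) F :
    {in words N n &, injective h} -> {in words N n, forall w, h w \in words N n} ->
  \sum_(w <- words N n) F w = \sum_(w <- words N n) F (h w).
Proof.
move=> h_inj h_in; rewrite -(big_map h predT F); apply: perm_big.
have uh : uniq (map h (words N n)) by rewrite map_inj_in_uniq ?words_uniq.
have sub : {subset map h (words N n) <= words N n}.
  by move=> _ /mapP[w /h_in hw ->].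
have [|_ eqw] := uniq_min_size uh sub; first by rewrite size_map.
by rewrite perm_sym; apply: uniq_perm; rewrite ?words_uniq.
Qed.

End BigWords.

(** * Counting words with prescribed strict steps *)

Fixpoint chain (b : nat -> bool) (x : nat) (w : seq nat) : bool :=
  if w is y :: w' then (x + b 0 <= y)%N && chain (fun k => b k.+1) y w' else true.

Lemma chainP (b : nat -> bool) x w :
  reflect (forall k, (k < size w)%N -> (nth 0 (x :: w) k + b k <= nth 0 w k)%N)
          (chain b x w).
Proof.
elim: w b x => [|y w IHw] b x /=; first by apply: ReflectT.
apply: (iffP andP) => [[xy /IHw yw] [|k] //= kw|xw]; first exact: yw.
by split; [exact: (xw 0)|apply/IHw => k kw; exact: (xw k.+1)].
Qed.

(** Hockey-stick identity; its lower boundary term ['C(k, n.+1)] vanishes because [k <= n]. *)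
Lemma sum_binomial_interval N x k n : (k <= n)%N -> (x <= N)%N ->
  (\sum_(y <- iota 0 N | x <= y) 'C(N - y.+1 + k, n) = 'C(N - x + k, n.+1))%N.
Proof.
move=> kn; elim: N x => [|N IHN] x xN.
  by rewrite big_nil bin_small // ltnS (leq_trans _ kn) // -[leqRHS]add0n leq_add2r.
rewrite -[iota 0 _]/(0%N :: iota 1 N) (iotaDl 1 0) big_cons big_map.
under eq_bigr do rewrite add1n subSS.
case: x xN => [_|x xN] /=; last exact: IHN.
have := IHN 0%N isT; rewrite !subn0 => IH0.
by rewrite subn1 /= IH0 addSn binS addnC.
Qed.

(** Induction on the length: the first letter [y] becomes the starting value for the remaining ones,
    and the sum over [y] is a hockey-stick sum. *)
Lemma sum_chain N n (b : nat -> bool) x : (x < N)%N ->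
  (\sum_(w <- words N n) chain b x w =
   'C(N.-1 - x + n - count b (iota 0 n), n))%N.
Proof.
elim: n b x => [|n IHn] b x xN; first by rewrite /= big_seq1 bin0.
rewrite [words N n.+1]/= big_allpairs_dep /=.
under eq_bigr => y _ do under eq_bigr => w _ do rewrite -mulnb.
under eq_bigr => y _ do rewrite -big_distrr /=.
rewrite (iotaDl 1 0) count_map.
set d := count _ (iota 0 n).
have dn : (d <= n)%N by rewrite -[leqRHS](size_iota 0) count_size.
transitivity (\sum_(y <- iota 0 N | x + b 0 <= y) 'C(N - y.+1 + (n - d), n))%N.
  rewrite [RHS]big_mkcond /= big_seq [RHS]big_seq; apply: eq_bigr => y.
  rewrite mem_iota /= => yN; rewrite IHn //.
  case: leqP => _; rewrite ?mul1n ?mul0n //; congr 'C(_, _).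
  rewrite -/d; lia.
rewrite sum_binomial_interval ?leq_subr //; last by case: (b 0); lia.
by congr 'C(_, _); case: (b 0); lia.
Qed.

Lemma card_words_chain N n (b : nat -> bool) :
  (\sum_(w <- words N n.+1)
      `[< forall k, (k < n)%N -> nth 0 w k + b k <= nth 0 w k.+1 >] =
   'C(N + n - count b (iota 0 n), n.+1))%N.
Proof.
set c := count b (iota 0 n).
have cn : (c <= n)%N by rewrite -[leqRHS](size_iota 0) count_size.
case: N => [|N].
  by rewrite big_nil bin_small // add0n ltnS leq_subr.
(* A letter 0 followed by a weak step is put in front, which leaves the first letter free. *)
pose b0 k := (0 < k)%N && b k.-1.
have bc : count b0 (iota 0 n.+1) = c by rewrite /= (iotaDl 1 0) count_map.
have -> : (N.+1 + n - c = N - 0 + n.+1 - c)%N by lia.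
rewrite -bc -(@sum_chain N.+1 n.+1 b0 0 isT) big_seq [RHS]big_seq; apply: eq_bigr => w.
rewrite mem_words => /andP[/eqP sw _]; congr nat_of_bool.
apply/asboolP/chainP => [wk [|k]|wk k kn] //; rewrite ?sw.
- exact: wk.
- by have := wk k.+1; rewrite sw ltnS; apply.
Qed.

(** * Words with a given standardization *)

(** Only pairs [x < y] are compared, and by [<=], so equal letters count as increasing from left to
    right. *)
Definition order_on (L : nat) (r : rel nat) (w : seq nat) : bool :=
  `[< (L <= size w)%N /\
      forall x y, (x < y < L)%N -> (nth 0 w x <= nth 0 w y)%N = r x y >].

Lemma size_one_line n (p : 'S_n) : size (one_line p) = n.
Proof. by rewrite size_map size_enum_ord. Qed.

Lemma nth_one_line n (p : 'S_n) (i : 'I_n) : nth 0%N (one_line p) i = (p i).+1.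
Proof. by rewrite (nth_map i) ?size_enum_ord // nth_ord_enum. Qed.

Lemma one_line_uniq n (p : 'S_n) : uniq (one_line p).
Proof. by rewrite map_inj_uniq ?enum_uniq // => i j [] /val_inj /perm_inj. Qed.

(* The standardization of w, ties being broken from left to right, is p. *)
Definition compat n (p : 'S_n) : pred (seq nat) :=
  order_on n (fun x y => nth 0 (one_line p) x <= nth 0 (one_line p) y)%N.

Lemma compatP n (p : 'S_n) w : size w = n ->
  reflect (forall i j : 'I_n, (i < j)%N ->
             (nth 0 w i <= nth 0 w j)%N = (p i <= p j)%N)
          (compat p w).
Proof.
move=> sw; apply: (iffP (asboolP _)) => [[_ H] i j ij|H].
  by rewrite H ?ij ?ltn_ord // !nth_one_line.
split=> [|x y /andP[xy yn]]; first by rewrite sw.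
have xn := ltn_trans xy yn.
have /= -> := nth_one_line p (Ordinal xn); have /= -> := nth_one_line p (Ordinal yn).
exact: (H (Ordinal xn) (Ordinal yn)).
Qed.

(** Listing the letters of a compatible word by increasing value of [p] gives a weakly increasing
    word with strict steps at the descents of [p^-1]; [h] undoes this rearrangement. *)
Lemma sum_compat N n (p : 'S_n.+1) :
  (\sum_(w <- words N n.+1) compat p w = 'C(N + n - ides p, n.+1))%N.
Proof.
pose h (w : seq nat) := mkseq (fun k => nth 0%N w (p (inord k))) n.+1.
have nth_h w (i : 'I_n.+1) : nth 0%N (h w) i = nth 0%N w (p i).
  by rewrite nth_mkseq // inord_val.
pose Q k := nth 0%N (one_line p^-1%g) k.
have QE (i : 'I_n.+1) : Q (p i) = i.+1 by rewrite /Q nth_one_line permK.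
have Qinj k l : (k < n.+1)%N -> (l < n.+1)%N -> Q k = Q l -> k = l.
  by move=> kn ln /eqP; rewrite nth_uniq ?size_one_line ?one_line_uniq // => /eqP.
rewrite (@reindex_words _ N n.+1 h).
- rewrite -(card_words_chain N n (fun k => Q k.+1 < Q k)%N).
  rewrite big_seq [RHS]big_seq; apply: eq_bigr => w.
  rewrite mem_words => /andP[/eqP sw _]; congr nat_of_bool.
  apply/compatP/asboolP => [|H k kn|H i j ij]; first by rewrite size_mkseq.
    have kn1 : (k < n.+1)%N by apply: leqW.
    have kn2 : (k.+1 < n.+1)%N by [].
    have q1 : Q k = ((p^-1)%g (Ordinal kn1)).+1 := nth_one_line _ (Ordinal kn1).
    have q2 : Q k.+1 = ((p^-1)%g (Ordinal kn2)).+1 := nth_one_line _ (Ordinal kn2).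
    have := Qinj _ _ kn1 kn2; have := H ((p^-1)%g (Ordinal kn1)) ((p^-1)%g (Ordinal kn2)).
    have := H ((p^-1)%g (Ordinal kn2)) ((p^-1)%g (Ordinal kn1)).
    rewrite !nth_h !permKV q1 q2 /=.
    set u := nat_of_ord (p^-1%g _); set v := nat_of_ord (p^-1%g _); lia.
  (* If [Q] drops from [k] to [l], then some step in between is a descent of [Q], hence strict. *)
  have {}H k l : (k < l <= n)%N -> (nth 0 w k + (Q l < Q k)%N <= nth 0 w l)%N.
    elim: l => // l IHl /andP[]; rewrite ltnS leq_eqVlt => /predU1P[-> ln|kl ln].
      exact: H.
    have := IHl; rewrite kl (ltnW ln) => /(_ isT).
    have := H l ln; lia.
  rewrite !nth_h.
  have := H (p i) (p j); have := H (p j) (p i); rewrite !QE.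
  have := ltn_ord (p i); have := ltn_ord (p j).
  have : p i <> p j :> nat by move=> /val_inj/perm_inj eij; rewrite eij ltnn in ij.
  lia.
- move=> v w; rewrite !mem_words => /andP[/eqP sv _] /andP[/eqP sw _] hvw.
  apply: (@eq_from_nth _ 0%N) => [|k]; rewrite sv ?sw // => kn.
  have := congr1 (fun u => nth 0%N u (p^-1%g (Ordinal kn))) hvw.
  by rewrite !nth_h permKV.
- move=> w; rewrite !mem_words size_mkseq eqxx => /andP[/eqP sw /allP Nw].
  apply/allP => _ /mapP[k _ ->]; apply: Nw.
  by rewrite mem_nth // sw.
Qed.

Lemma card_ord_lt n k : (k <= n)%N -> #|[pred i : 'I_n | (i < k)%N]| = k.
Proof.
by move=> kn; rewrite -sum1_card -(big_ord_widen _ (fun=> 1%N)) // sum1_card card_ord.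
Qed.

Lemma perm_rank n (p : 'S_n) i : #|[pred j | (p j < p i)%N]| = p i.
Proof.
rewrite -[RHS](@card_ord_lt n) 1?ltnW // -!sum1_card.
by rewrite [RHS](reindex_inj (@perm_inj _ p)).
Qed.

(** The word fixes all comparisons between values of [p], and by [perm_rank] these fix the
    values. *)
Lemma compat_inj n (p q : 'S_n) w :
  size w = n -> compat p w -> compat q w -> p = q.
Proof.
move=> sw /(compatP p sw) pw /(compatP q sw) qw.
apply/permP => i; apply/val_inj; rewrite /= -(perm_rank p) -(perm_rank q).
apply: eq_card => j; rewrite !inE.
case: (ltngtP i j) => [ij|ji|/val_inj->]; last by rewrite !ltnn.
  by rewrite !ltnNge -pw // qw.
have pe (r : 'S_n) : (r j < r i)%N = (r j <= r i)%N.
  rewrite ltn_neqAle (inj_eq val_inj) (inj_eq perm_inj).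
  by rewrite -(inj_eq val_inj) /= ltn_eqF.
by rewrite !pe -pw // qw.
Qed.

(** The permutation sends a position to its rank when positions are ordered by letter, ties being
    broken from left to right. *)
Lemma compat_exists n w : size w = n -> exists p : 'S_n, compat p w.
Proof.
move=> sw.
pose r (i j : 'I_n) :=
  (nth 0 w i < nth 0 w j)%N || (nth 0 w i == nth 0 w j)%N && (i < j)%N.
have r_irr i : r i i = false by rewrite /r; lia.
have r_trans i j k : r i j -> r j k -> r i k by rewrite /r; lia.
have rk_lt i : (#|[pred j | r j i]| < n)%N.
  rewrite -[ltnRHS]card_ord; apply: proper_card; apply/properP.
  by split; [apply/subsetP|exists i; rewrite // !inE r_irr].
have rk_homo i j : r i j -> (#|[pred k | r k i]| < #|[pred k | r k j]|)%N.
  move=> rij; apply: proper_card; apply/properP; split.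
    by apply/subsetP => k; rewrite !inE => /r_trans; apply.
  by exists i; rewrite !inE ?r_irr.
have rk_inj : injective (fun i => Ordinal (rk_lt i)).
  move=> i j /(congr1 val) /= eij; apply/eqP/negPn/negP => nij.
  have : r i j || r j i by move: nij; rewrite -(inj_eq val_inj) /r /=; lia.
  by case/orP => /rk_homo; rewrite eij ltnn.
exists (perm rk_inj); apply/compatP => // i j ij; rewrite !permE /=.
case: leqP => wij; first by apply/esym/ltnW/rk_homo; rewrite /r; lia.
by apply/esym/negbTE; rewrite -ltnNge; apply/rk_homo; rewrite /r wij.
Qed.

(* The order relation r (see order_on) of a weakly increasing word in which the
   entries at positions k and k + 1, if k is in s, are distinct and have been exchanged. *)
Definition swaps (s : seq nat) : rel nat :=
  fun x y => ~~ ((y == x.+1) && (x \in s)).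

(** * Occurrences of the pattern in words *)

(** This tests for an occurrence at the start of the word. Positions count from 0, so the exchanged
    pair sits at [a.-1] and [a]. *)
Definition has_pattern (m a : nat) : pred (seq nat) := order_on m (swaps [:: a.-1]).

Fixpoint occw (B : pred (seq nat)) (w : seq nat) : nat :=
  if w is _ :: w' then B w + occw B w' else 0.

Lemma occwE (B : pred (seq nat)) m w : (0 < m)%N -> (forall v, B v -> (m <= size v)%N) ->
  occw B w = count (fun j => B (drop j w)) (iota 0 ((size w).+1 - m)).
Proof.
move=> m0 Bm; set k := ((size w).+1 - m)%N.
have -> : occw B w = count (fun j => B (drop j w)) (iota 0 (size w)).
  elim: {k} w => //= x w ->; rewrite (iotaDl 1 0) count_map.
  by congr (_ + _)%N; apply: eq_count => j; rewrite /= add1n.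
have kw : (k <= size w)%N by rewrite /k; lia.
rewrite -(subnKC kw) iotaD count_cat [X in (_ + X)%N](@eq_in_count _ _ pred0).
  by rewrite count_pred0 addn0.
move=> j; rewrite mem_iota => /andP[kj _]; apply/negbTE/negP => /Bm.
by rewrite size_drop; move: kj; rewrite /k; lia.
Qed.

Lemma order_on_size L r w : order_on L r w -> (L <= size w)%N.
Proof. by move=> /asboolP[]. Qed.

Lemma order_on_take L r w : order_on L r (take L w) = order_on L r w.
Proof.
have [wL|Lw] := leqP (size w) L; first by rewrite take_oversize.
apply: asbool_equiv_eq; rewrite size_take Lw leqnn (ltnW Lw).
by split=> -[_ H]; split=> // x y xyL; move: (xyL) (H x y xyL) => /andP[xy yL];
  rewrite !nth_take // (ltn_trans xy).
Qed.

Section SwapPattern.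
Variables m a : nat.
Hypotheses (a_gt0 : (0 < a)%N) (am : (a < m)%N).

Lemma size_swap_pattern : size (swap_pattern m a) = m.
Proof. by rewrite /swap_pattern !size_cat !size_iota /=; lia. Qed.

Lemma nth_swap_pattern k : (k < m)%N -> nth 0%N (swap_pattern m a) k =
  if k == a.-1 then a.+1 else if k == a then a else k.+1.
Proof.
move=> km; rewrite /swap_pattern !nth_cat !size_iota /=.
have [ka|ak] := ltnP k a.-1.
  have [-> ->] : (k == a.-1) = false /\ (k == a) = false by split; lia.
  by rewrite nth_iota.
have [->|k1] := eqVneq k a.-1; first by rewrite subnn.
have [->|k2] := eqVneq k a; first by rewrite (_ : a - a.-1 = 1)%N //; lia.
have -> : (k - a.-1 < 2)%N = false by lia.
by rewrite nth_iota; lia.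
Qed.

Lemma has_pattern_swap_pattern : has_pattern m a (swap_pattern m a).
Proof.
apply/asboolP; rewrite size_swap_pattern; split=> // x y /andP[xy ym].
rewrite !nth_swap_pattern ?(ltn_trans xy) // /swaps inE.
by do 4?case: ifP; lia.
Qed.

Lemma perm_swap_pattern : perm_eq (swap_pattern m a) (iota 1 m).
Proof.
have -> : iota 1 m = iota 1 a.-1 ++ [:: a; a.+1] ++ iota a.+2 (m - a.+1).
  have -> : m = (a.-1 + (2 + (m - a.+1)))%N by lia.
  rewrite !iotaD /= add1n prednK //; congr (_ ++ [:: _, _ & iota _ _]); lia.
rewrite /swap_pattern perm_cat2l; exact: (permEl (perm_catCA [:: _] [:: _] _)).
Qed.

Lemma std_swap_pattern : std (swap_pattern m a) = swap_pattern m a.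
Proof.
rewrite /std -[RHS]map_id; apply/eq_in_map => x.
rewrite (perm_mem perm_swap_pattern) (seq.permP perm_swap_pattern) mem_iota => xm.
have -> : m = (x + (m - x))%N by lia.
rewrite iotaD count_cat (@eq_in_count _ _ predT); last first.
  by move=> y; rewrite mem_iota /=; lia.
rewrite count_predT size_iota (@eq_in_count _ _ pred0) ?count_pred0 ?addn0 //.
by move=> y; rewrite mem_iota /=; lia.
Qed.

Lemma nth_std w k : (k < size w)%N ->
  nth 0%N (std w) k = count (fun y => y <= nth 0 w k)%N w.
Proof. exact: nth_map. Qed.

Lemma leq_std w x y : uniq w -> (x < size w)%N -> (y < size w)%N ->
  (nth 0 (std w) x <= nth 0 (std w) y)%N = (nth 0 w x <= nth 0 w y)%N.
Proof.
move=> uw xw yw; rewrite !nth_std //; have [xy|yx] := leqP (nth 0%N w x).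
  by apply: sub_count => z /= /leq_trans; apply.
apply/negbTE; rewrite -ltnNge.
rewrite -!size_filter.
have : {subset nth 0%N w x :: [seq z <- w | (z <= nth 0 w y)%N]
          <= [seq z <- w | (z <= nth 0 w x)%N]}.
  move=> z; rewrite inE !mem_filter => /predU1P[->|/andP[zy ->]].
    by rewrite leqnn mem_nth.
  by rewrite andbT (leq_trans zy (ltnW yx)).
by apply: uniq_leq_size; rewrite /= mem_filter leqNgt yx filter_uniq.
Qed.

Lemma eq_std v w : size v = size w ->
    (forall x y, (x < size w)%N -> (y < size w)%N ->
       (nth 0 v x <= nth 0 v y)%N = (nth 0 w x <= nth 0 w y)%N) ->
  std v = std w.
Proof.
move=> svw H; apply: (@eq_from_nth _ 0%N) => [|x]; rewrite !size_map // => xv.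
have cntE (u : seq nat) z :
    count (fun y => y <= z)%N u = count (fun k => nth 0 u k <= z)%N (iota 0 (size u)).
  by rewrite -{1}[u](mkseq_nth 0%N) count_map.
rewrite !nth_std -?svw // !cntE svw; apply: eq_in_count => y.
by rewrite mem_iota /= => yw; rewrite H // -svw.
Qed.

Lemma std_eq_swap_pattern w : uniq w -> size w = m ->
  (std w == swap_pattern m a) = has_pattern m a w.
Proof.
move=> uw sw; have /asboolP[_ sP] := has_pattern_swap_pattern.
apply/eqP/asboolP => [stdw|[_ H]].
  split=> [|x y xym]; rewrite ?sw // -sP // -stdw leq_std ?sw //; lia.
rewrite -std_swap_pattern; apply: eq_std; rewrite size_swap_pattern // => x y xm ym.
have us : uniq (swap_pattern m a) by rewrite (perm_uniq perm_swap_pattern) iota_uniq.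
case: (ltngtP x y) => [xy|yx|->]; last by rewrite !leqnn.
  by rewrite H ?xy // sP ?xy.
(* The hypothesis only covers [x < y]; for distinct letters the reverse comparison is the
   negation. *)
have nle (v : seq nat) : uniq v -> size v = m ->
    (nth 0 v x <= nth 0 v y)%N = ~~ (nth 0 v y <= nth 0 v x)%N.
  move=> uv sv; rewrite -ltnNge ltn_neqAle nth_uniq ?sv //.
  by rewrite (ltn_eqF yx : (x == y) = false) || rewrite (gtn_eqF yx).
by rewrite !nle ?size_swap_pattern // H ?yx // sP ?yx.
Qed.

(** Whether a window is an occurrence depends only on comparisons inside it, and these agree for [w]
    and [p]. *)
Lemma occ_compat n (p : 'S_n) w : size w = n -> compat p w ->
  occ (swap_pattern m a) p = occw (has_pattern m a) w.
Proof.
move=> sw /asboolP[_ pw]; rewrite (@occwE _ m); first last.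
- exact: order_on_size.
- exact: leq_ltn_trans am.
rewrite /occ size_swap_pattern sw; apply: eq_in_count => j.
rewrite mem_iota /= => jn.
have sz : size (take m (drop j (one_line p))) = m.
  by rewrite size_takel // size_drop size_one_line; lia.
rewrite std_eq_swap_pattern ?take_uniq ?drop_uniq ?one_line_uniq //.
rewrite /has_pattern order_on_take; apply: asbool_equiv_eq.
rewrite !size_drop size_one_line sw; split=> -[mn H]; split=> // x y xym.
  by rewrite -H // !nth_drop pw //; lia.
by rewrite -H // !nth_drop pw //; lia.
Qed.

End SwapPattern.

(** * Clusters of overlapping occurrences *)

Definition sparse (s : seq nat) : Prop := {in s, forall x, x.+1 \notin s}.

(** Exchanging the disjoint pairs given by [s] is an involution, hence its own inverse, and its
    descents are exactly the elements of [s]; so [sum_compat] applies with [size s] inverse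
    descents. *)
Lemma sum_swaps N n s : (0 < n)%N -> uniq s -> sparse s ->
    {in s, forall x, x.+1 < n}%N ->
  (\sum_(w <- words N n) order_on n (swaps s) w = 'C(N + n.-1 - size s, n))%N.
Proof.
case: n => // n _ us sep sn.
pose f x := if x \in s then x.+1 else if (0 < x)%N && (x.-1 \in s) then x.-1 else x.
have fK : involutive f.
  move=> x; rewrite {2}/f; case: (boolP (x \in s)) => [xs|nxs].
    by rewrite /f (negbTE (sep x xs)) /= xs.
  case: ifP => [/andP[x0 xs]|nx]; last by rewrite /f (negbTE nxs) nx.
  by rewrite /f xs prednK.
have f_ord (i : 'I_n.+1) : (f i < n.+1)%N.
  rewrite /f; case: ifP => [/sn //|_]; case: ifP => // _.
  exact: leq_ltn_trans (leq_pred i) _.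
have f_inj : injective (fun i => Ordinal (f_ord i)).
  by move=> i j [] /(can_inj fK) /val_inj.
pose p := perm f_inj.
have pE (i : 'I_n.+1) : p i = f i :> nat by rewrite permE.
have pV : (p^-1)%g = p.
  apply/permP => i; apply: (@perm_inj _ p); rewrite permKV.
  by apply/val_inj; rewrite /= !pE fK.
have olE k : (k < n.+1)%N -> nth 0%N (one_line p) k = (f k).+1.
  by move=> kn; rewrite (nth_one_line p (Ordinal kn)) pE.
have fS x : (f x.+1 < f x)%N = (x \in s).
  rewrite /f /=; case: (boolP (x \in s)) => [xs|nxs].
    by rewrite (negbTE (sep x xs)) ltnSn.
  by case: ifP => _; case: ifP => _; lia.
have f_ltn x y : (x < y)%N -> (f x <= f y)%N = swaps s x y.
  rewrite /swaps; case: eqVneq => [-> _|nyx xy]; first by rewrite -fS -leqNgt.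
  by rewrite /f; do 4?case: ifP => ?; lia.
rewrite addnC -(_ : ides p = size s) 1?addnC; last first.
  rewrite /ides pV /des -size_filter; apply/perm_size/uniq_perm => //.
    by rewrite filter_uniq ?iota_uniq.
  move=> x; rewrite mem_filter mem_iota /= andbC.
  case: (ltnP x n) => xn; first by rewrite !olE ?ltnS ?fS // ltnW.
  by apply/esym/negbTE/negP => /sn; lia.
rewrite -sum_compat; apply: eq_bigr => w _; congr nat_of_bool.
apply: asbool_equiv_eq; split=> -[sw H]; split=> // x y xyn.
  by rewrite H // !olE ?ltnS ?f_ltn //; lia.
by rewrite H // !olE ?ltnS ?f_ltn //; lia.
Qed.

(* s lists the positions of the exchanged pairs of a cluster whose last
   occurrence starts at position o. *)
Definition cluster a o (s : seq nat) : Prop :=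
  [/\ o + a.-1 \in s, uniq s, sparse s & {in s, forall x, x <= o + a.-1}%N].

Lemma cluster1 a : cluster a 0 [:: a.-1].
Proof.
by split; rewrite ?inE // => x; rewrite !inE => /eqP->; lia.
Qed.

Lemma cluster_extend a o s j : (2 <= j)%N -> cluster a o s ->
  cluster a (o + j) (o + j + a.-1 :: s).
Proof.
move=> j2 [os us ss so]; split; rewrite ?mem_head //=.
- by rewrite us andbT; apply/negP => /so; lia.
- move=> x; rewrite !inE => /predU1P[->|xs]; rewrite negb_or.
    by apply/andP; split; [lia|apply/negP => /so; lia].
  by rewrite ss // andbT; have := so x xs; lia.
- by move=> x; rewrite inE => /predU1P[-> //|/so]; lia.
Qed.

Section Clusters.
Variables m a : nat.
Hypotheses (hm : (5 <= m)%N) (ha : (2 <= a <= m - 2)%N).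

(** The smallest distance between the starts of two overlapping occurrences. *)
Let shift_min := (m - minn a (m - a))%N.

(** The two windows force the order of all letters: positions that share no window are compared
    through a position of the overlap. *)
Lemma order_on_extend o s j w : cluster a o s -> (shift_min <= j < m)%N ->
  order_on (o + m) (swaps s) w && has_pattern m a (drop (o + j) w) =
  order_on (o + j + m) (swaps (o + j + a.-1 :: s)) w.
Proof.
move=> [os us ss so] jm.
have lt_s x : x \in s -> (x <= o + a.-1)%N := so x.
have {jm} [j1 j2 j3 j4] : [/\ 3 <= j, a <= j, m <= j + a & j < m]%N.
  by split; move: jm; rewrite /shift_min; lia.
apply/andP/asboolP => [[/asboolP[sw H1] /asboolP[]]|[sw H]].
  rewrite size_drop => sw2 H2; split=> [|x y /andP[xy yjm]]; first lia.
  have {}H2 x' y' : (o + j <= x' < y')%N -> (y' < o + j + m)%N ->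
      (nth 0 w x' <= nth 0 w y')%N = ~~ ((y' == x'.+1) && (x' == o + j + a.-1)%N).
    move=> /andP[x'1 x'2] y'3; have := H2 (x' - (o + j))%N (y' - (o + j))%N.
    rewrite !nth_drop !subnKC; [|lia..]; rewrite /swaps inE => ->; lia.
  rewrite /swaps inE in H1 *.
  have [yom|omy] := ltnP y (o + m).
    by rewrite H1 ?xy // /swaps; case: (x \in s); lia.
  have [ojx|xoj] := leqP (o + j) x.
    rewrite H2 ?ojx ?xy //; case: (boolP (x \in s)) => [/lt_s|_]; first lia.
    by rewrite orbF.
  have -> : (y == x.+1) = false by lia.
  (* A position [q] of the overlap serves if neither [x, q] nor [q, y] is an exchanged pair. *)
  have via q : (o + j <= q < o + m)%N ->
      ~~ ((q == x.+1) && (x \in s)) -> ~~ ((y == q.+1) && (q == o + j + a.-1)%N) ->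
      (nth 0 w x <= nth 0 w y)%N.
    move=> qb xq qy; apply: (@leq_trans (nth 0%N w q)).
      by rewrite H1 //; lia.
    by rewrite H2 //; lia.
  (* The last position of the overlap serves unless the new pair starts there, that is, unless
     [j + a = m]. *)
  have [jam|njam] := eqVneq (j + a)%N m; last first.
    apply: (via (o + m).-1); first lia; last lia.
    by case: (boolP (x \in s)) => [/lt_s|_]; lia.
  (* The first position of the overlap serves unless it ends the last old pair, that is, unless
     [j = a]. In that case [m = 2a], and [m >= 5] gives [a >= 3], so [o + j + 1] lies strictly
     between the two bad positions. *)
  have [ja|nja] := eqVneq j a.
    by apply: (via (o + j).+1); [lia|case: (x \in s); lia|lia].
  apply: (via (o + j)%N); [lia| |lia].
  by case: (boolP (x \in s)) => [/lt_s|_]; lia.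
(* Conversely, [m <= j + a] keeps the new pair from lying inside the old window, and [a <= j] makes
   every old pair start before the new window. *)
split; apply/asboolP.
  split=> [|x y xy]; first lia.
  rewrite H; last lia.
  by rewrite /swaps inE; case: (boolP (x \in s)) => _; lia.
rewrite size_drop; split=> [|x y xy]; first lia.
rewrite !nth_drop H; last lia.
rewrite /swaps !inE; case: (boolP (o + j + x \in s)%N) => [/lt_s|_]; lia.
Qed.

(** If [j + a < m], the exchanged pair of the new occurrence lies in the old window, where it would
    have to increase; otherwise [j < a], and the last old pair lies in the new window, with the same
    contradiction. *)
Lemma no_overlap o s j w : cluster a o s -> (1 <= j < shift_min)%N ->
  order_on (o + m) (swaps s) w -> ~~ has_pattern m a (drop (o + j) w).
Proof.
move=> [os us ss so] jm /asboolP[sw H1]; apply/negP => /asboolP[].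
rewrite size_drop => sw2 H2; have [jam|jam] := ltnP (j + a) m.
  have := H1 (o + j + a.-1)%N (o + j + a)%N.
  have := H2 a.-1 a; rewrite /swaps inE !nth_drop.
  case: (boolP (o + j + a.-1 \in s)%N) => [/so|_]; lia.
have := H1 (o + a.-1)%N (o + a)%N; rewrite /swaps os.
have := H2 (a.-1 - j)%N (a - j)%N; rewrite /swaps inE !nth_drop.
have ja : (j < a)%N by move: jm; rewrite /shift_min; lia.
rewrite (_ : o + j + (a.-1 - j) = o + a.-1)%N; last lia.
rewrite (_ : o + j + (a - j) = o + a)%N; lia.
Qed.

End Clusters.

(** * Weighted word sums and their cluster recursion *)

Section WordSums.
Variables (K : comNzRingType) (c : K) (m a N : nat).
Hypotheses (hm : (5 <= m)%N) (ha : (2 <= a <= m - 2)%N).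

Local Notation B := (has_pattern m a).

Definition word_weight (w : seq nat) : K := c ^+ occw B w.

Definition word_sum n : K := \sum_(w <- words N n) word_weight w.

(* Since c ^+ occw is the sum of (c - 1) ^+ k over the choices of k marked
   occurrences, the last factor accounts for all marks after position o. *)
Definition cluster_sum o s n : K :=
  \sum_(w <- words N n)
    (order_on (o + m) (swaps s) w)%:R * word_weight (drop o.+1 w).

(** The first position contributes [1 + (c - 1)] if an occurrence starts there, the two terms
    meaning unmarked and marked, and 1 otherwise. *)
Lemma word_weightE w : word_weight w =
  word_weight (drop 1 w) + (c - 1) * ((B w)%:R * word_weight (drop 1 w)).
Proof.
rewrite /word_weight; case: w => [|x w].
  suff -> : B [::] = false by rewrite mul0r mulr0 addr0.
  by apply/negbTE/negP => /order_on_size; rewrite leqn0 => /eqP m0; move: hm; rewrite m0.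
rewrite /= drop0; case: (B _); last by rewrite !(mul0r, mulr0, addr0).
by rewrite add1n exprS !mul1r mulrBl mul1r addrC subrK.
Qed.

(** Case distinction on the first marked occurrence after position [o]: it starts at [o + j] with
    [j <= k], or there is none up to [o + k]. *)
Lemma word_weight_drop o k w : word_weight (drop o.+1 w) =
  word_weight (drop (o + k.+1) w) +
  (c - 1) * \sum_(1 <= j < k.+1)
    (B (drop (o + j) w))%:R * word_weight (drop (o + j).+1 w).
Proof.
elim: k => [|k IHk]; first by rewrite big_geq // mulr0 addr0 addn1.
rewrite IHk [in RHS]big_nat_recr //= mulrDr.
rewrite (word_weightE (drop (o + k.+1) w)) drop_drop add1n -addnS.
by rewrite -addrA [_ * _ + _ * _]addrC.
Qed.

Lemma sum_order_on L r n :
  \sum_(w <- words N n) (order_on L r w)%:R * word_weight (drop L w) =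
  if (L <= n)%N then (\sum_(w <- words N L) order_on L r w)%N%:R * word_sum (n - L)
  else 0.
Proof.
case: leqP => [Ln|nL]; last first.
  rewrite big_seq big1 // => w; rewrite mem_words => /andP[/eqP sw _].
  case: (boolP (order_on _ _ _)) => [/order_on_size|_]; last by rewrite mul0r.
  by rewrite sw leqNgt nL.
rewrite -{1}(subnKC Ln) sum_words_cat natr_sum mulr_suml.
rewrite big_seq [RHS]big_seq; apply: eq_bigr => u.
rewrite mem_words => /andP[/eqP su _]; rewrite mulr_sumr; apply: eq_bigr => v _.
by rewrite -[in LHS]order_on_take drop_size_cat // take_size_cat.
Qed.

(** Either no marked occurrence overlaps the last one and the cluster ends, or the next one starts
    at [o + j] with [j < m]. Small [j] are excluded by [no_overlap]; the others give a longer
    cluster by [order_on_extend]. *)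
Lemma cluster_sum_rec o s n : cluster a o s ->
  cluster_sum o s n =
    (if (o + m <= n)%N
     then 'C(N + (o + m).-1 - size s, o + m)%:R * word_sum (n - (o + m)) else 0) +
    (c - 1) * \sum_(m - minn a (m - a) <= j < m)
      cluster_sum (o + j) (o + j + a.-1 :: s) n.
Proof.
move=> cl; have [os us ss so] := cl.
rewrite -(@sum_swaps N (o + m)) //; last 2 first.
- lia.
- by move=> x /so; lia.
rewrite -sum_order_on exchange_big /= mulr_sumr -big_split /=.
apply: eq_bigr => w _.
rewrite (@word_weight_drop o m.-1) prednK; last lia.
rewrite mulrDr; congr (_ + _); rewrite mulrCA; congr (_ * _).
rewrite (@big_cat_nat _ _ _ (m - minn a (m - a))) /=; [|lia|lia].
rewrite mulrDr [X in X + _]mulr_sumr big1_seq ?add0r; last first.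
  move=> j; rewrite mem_index_iota => jm.
  case: (boolP (order_on _ _ _)) => [ow|_]; last by rewrite mul0r.
  by rewrite (negbTE (no_overlap _ _ cl jm ow)) // mul0r mulr0.
rewrite mulr_sumr; apply: eq_big_nat => j jm; rewrite mulrA -natrM mulnb.
by rewrite (order_on_extend hm ha _ cl jm).
Qed.

Lemma word_sum0 : word_sum 0 = 1.
Proof. by rewrite /word_sum /= big_seq1. Qed.

(** The first position is either unmarked, so its letter is free, or it starts a cluster. *)
Lemma word_sumS n : word_sum n.+1 =
  N%:R * word_sum n + (c - 1) * cluster_sum 0 [:: a.-1] n.+1.
Proof.
rewrite /word_sum; under eq_bigr do rewrite word_weightE.
rewrite big_split /=; congr (_ + _).
  rewrite big_allpairs_dep /=; under eq_bigr do under eq_bigr do rewrite drop0.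
  by rewrite big_const_seq count_predT size_iota iter_addr_0 mulr_natl.
by rewrite -mulr_sumr.
Qed.

End WordSums.

(** * From words to permutations *)

Lemma ides_lt n (p : 'S_n.+1) : (ides p <= n)%N.
Proof. by rewrite -[leqRHS](size_iota 0) count_size. Qed.

(** Words are grouped by the unique permutation with which they are compatible. *)
Lemma word_sum_perm (K : comNzRingType) (c : K) m a N n :
    (0 < a)%N -> (a < m)%N ->
  word_sum c m a N n.+1 =
    \sum_(p : 'S_n.+1)
      c ^+ occ (swap_pattern m a) p * 'C(N + n - ides p, n.+1)%:R.
Proof.
move=> a0 am; under [RHS]eq_bigr do rewrite -sum_compat natr_sum mulr_sumr.
rewrite exchange_big /word_sum big_seq [RHS]big_seq; apply: eq_bigr => w.
rewrite mem_words => /andP[/eqP sw _].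
have [p pw] := compat_exists sw.
rewrite (bigD1 p) //= pw mulr1 big1 ?addr0 => [|q qp]; last first.
  case: (boolP (compat q w)) => [qw|_]; last by rewrite mulr0.
  by rewrite (compat_inj sw qw pw) eqxx in qp.
by rewrite /word_weight (occ_compat a0 am sw pw).
Qed.

(** * Coefficients of power series *)

Section Series.
Variable R : comUnitRingType.
Implicit Types f g : fps R.

Fact fpsC_zmod_morphism : zmod_morphism (@fpsC R).
Proof. by move=> x y; apply: fpsP => -[|k] //=; rewrite subr0. Qed.
Fact fpsC_monoid_morphism : monoid_morphism (@fpsC R).
Proof.
by split=> // x y; apply: fpsP => k; rewrite fcoef_fpsCM /=; case: eqP; rewrite ?mulr0.
Qed.
HB.instance Definition _ :=
  GRing.isZmodMorphism.Build R (fps R) (@fpsC R) fpsC_zmod_morphism.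
HB.instance Definition _ :=
  GRing.isMonoidMorphism.Build R (fps R) (@fpsC R) fpsC_monoid_morphism.

Lemma fcoef_fpsXM f k : fcoef (fpsX R * f) k = if k is k'.+1 then fcoef f k' else 0.
Proof.
rewrite fcoefM big_ord_recl /= mul0r add0r; case: k => [|k]; first by rewrite big_ord0.
by rewrite big_ord_recl /= mul1r subn1 big1 ?addr0 // => j _; rewrite mul0r.
Qed.

Lemma fcoef_fpsXnM n f k :
  fcoef (fpsX R ^+ n * f) k = if (n <= k)%N then fcoef f (k - n) else 0.
Proof.
elim: n k => [|n IHn] [|k]; rewrite ?mul1r ?subn0 //.
  by rewrite exprS -mulrA fcoef_fpsXM.
by rewrite exprS -mulrA fcoef_fpsXM IHn.
Qed.

Lemma unit_sub1X : 1 - fpsX R \is a GRing.unit.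
Proof. by rewrite fps_unitE fcoefD fcoefN /= subr0 unitr1. Qed.

Lemma fcoef_sub1X_inv n k : fcoef ((1 - fpsX R) ^- n.+1) k = 'C(k + n, n)%:R.
Proof.
suff -> : (1 - fpsX R) ^- n.+1 = Fps (fun i => 'C(i + n, n)%:R) by [].
elim: n {k} => [|n IHn]; apply: (mulIr unit_sub1X).
  rewrite expr1 mulVr ?unit_sub1X //; apply: fpsP => -[|k].
    by rewrite mulrBr mulr1 fcoefD fcoefN [_ * fpsX R]mulrC fcoef_fpsXM /= subr0.
  by rewrite mulrBr mulr1 fcoefD fcoefN [_ * fpsX R]mulrC fcoef_fpsXM /= !bin0 subrr.
rewrite exprS invrM ?unitrX ?unit_sub1X // mulrVK ?unit_sub1X // IHn.
apply: fpsP => k; rewrite mulrBr mulr1 fcoefD fcoefN [_ * fpsX R]mulrC fcoef_fpsXM.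
case: k => [|k] /=; first by rewrite !add0n !binn subr0.
by rewrite !addSn !addnS binS natrD addrAC subrr add0r.
Qed.

End Series.

Lemma sum_shifts (V : nmodType) (F : nat -> V) m i : (i <= m)%N ->
  \sum_(1 <= l < i.+1) F (m - l)%N = \sum_(m - i <= j < m) F j.
Proof.
elim: i => [|i IHi] im; first by rewrite !big_geq ?subn0.
rewrite big_nat_recr //= IHi 1?ltnW // [RHS]big_ltn; last lia.
by rewrite addrC subnSK.
Qed.

(** * Closed forms of the cluster series *)

Section Bivariate.
Variables (K : comUnitRingType) (c : K).
Local Notation t := (var_t : fps_xt K).
Local Notation x := (var_x : fps_xt K).
Local Notation z := (x / (1 - t)).
Local Notation s := (cst_xt c).

Lemma unit_sub1t : 1 - t \is a GRing.unit.
Proof. exact: unit_sub1X. Qed.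

(** For [d < L], the coefficient of [t ^+ N] counts, with factor [x ^+ L], the words of length [L]
    over [N] letters whose standardization is a fixed permutation with [d] inverse descents. *)
Definition ordered_series d L : fps_xt K := t ^+ d.+1 * z ^+ L / (1 - t).

Lemma fcoef_ordered_series d L N : (d < L)%N ->
  fcoef (ordered_series d L) N = fpsX K ^+ L * 'C(N + L.-1 - d, L)%:R.
Proof.
move=> dL; have -> : ordered_series d L = fpsC (fpsX K ^+ L) * (t ^+ d.+1 / (1 - t) ^+ L.+1).
  rewrite /ordered_series expr_div_n [(1 - t) ^+ L.+1]exprSr invrM ?unitrX ?unit_sub1t //.
  rewrite rmorphXn /=; rewrite /var_x; ring.
rewrite fcoef_fpsCM fcoef_fpsXnM fcoef_sub1X_inv; congr (_ * _).
case: ltnP => [dN|Nd]; first by congr (_ *+ _); congr 'C(_, _); lia.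
by rewrite bin_small //; lia.
Qed.

Lemma fcoef_mul_ordered_series (f : fps K) d L N n : (d < L)%N ->
  fcoef (f * fcoef (ordered_series d L) N) n =
  if (L <= n)%N then 'C(N + L.-1 - d, L)%:R * fcoef f (n - L) else 0.
Proof.
move=> dL; rewrite fcoef_ordered_series // mulrCA fcoef_fpsXnM.
by rewrite -(rmorph_nat (@fpsC K)) mulrC fcoef_fpsCM.
Qed.

Section Clusters.
Variables m a : nat.
Hypotheses (hm : (5 <= m)%N) (ha : (2 <= a <= m - 2)%N).

Local Notation i := (minn a (m - a)).
Local Notation Z := (\sum_(1 <= l < i.+1) z ^+ (m - l)).

(** A geometric series: each further marked occurrence, overlapping in [l] letters, contributes the
    factor [(s - 1) * t * z ^+ (m - l)]. *)
Definition cluster_series d L : fps_xt K :=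
  t ^+ d.+1 * z ^+ L / ((1 - t) * (1 - (s - 1) * t * Z)).

Lemma unit_cluster_denominator : 1 - (s - 1) * t * Z \is a GRing.unit.
Proof. by rewrite [(s - 1) * t]mulrC -mulrA unit_subr_var_t. Qed.

Lemma cluster_series_rec d L : cluster_series d L =
  ordered_series d L + (s - 1) * \sum_(m - i <= j < m) cluster_series d.+1 (L + j).
Proof.
have uZ := unit_cluster_denominator; have ut := unit_sub1t.
set u := s - 1; set D := 1 - (s - 1) * t * Z.
have csE d' L' : cluster_series d' L' = ordered_series d' L' / D.
  by rewrite /cluster_series /ordered_series invrM // mulrA mulrAC.
apply: (mulIr uZ); rewrite -/D [RHS]mulrDl -(mulrA u) mulr_suml.
under [in RHS]eq_bigr do rewrite csE divrK //.
rewrite csE divrK // -(@sum_shifts _ (fun j => ordered_series d.+1 (L + j))); last lia.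
rewrite /ordered_series; under eq_bigr do rewrite exprD exprS mulrA mulrAC.
rewrite -mulr_sumr /D -/u; ring.
Qed.

Variable N : nat.
Local Notation W := (Fps (word_sum c m a N)).

Lemma fcoef_cst_sub1M (f : fps_xt K) :
  fcoef ((s - 1) * f) N = fpsC (c - 1) * fcoef f N.
Proof.
by rewrite -[1](rmorph1 (@fpsC _ \o @fpsC K)) -(rmorphB (@fpsC _ \o @fpsC K)) fcoef_fpsCM.
Qed.

Lemma cluster_sum_small o s' n : (n < o + m)%N -> cluster_sum c m a N o s' n = 0.
Proof.
move=> nom; rewrite /cluster_sum big_seq big1 // => w.
rewrite mem_words => /andP[/eqP sw _].
case: (boolP (order_on _ _ _)) => [/order_on_size|_]; last by rewrite mul0r.
by rewrite sw leqNgt nom.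
Qed.

Lemma fcoef_mul_cluster_series_small (f : fps K) d L n : (n < L)%N ->
  fcoef (f * fcoef (cluster_series d L) N) n = 0.
Proof.
move=> nL; have -> : cluster_series d L = fpsC (fpsX K ^+ L) *
    (t ^+ d.+1 / (1 - t) ^+ L / ((1 - t) * (1 - (s - 1) * t * Z))).
  by rewrite /cluster_series expr_div_n rmorphXn /= /var_x; ring.
by rewrite fcoef_fpsCM mulrCA fcoef_fpsXnM leqNgt nL.
Qed.

(** Both sides satisfy the same recursion, in which [o] grows, and both vanish once the cluster is
    longer than [n]. *)
Lemma fcoef_mul_cluster_series o s' n : cluster a o s' ->
  (size s' < o + m)%N ->
  fcoef (W * fcoef (cluster_series (size s') (o + m)) N) n = cluster_sum c m a N o s' n.
Proof.
have [k] := ubnP (n - o); elim: k o s' => // k IHk o s' kno cl so.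
have [nom|omn] := ltnP n (o + m).
  by rewrite cluster_sum_small // fcoef_mul_cluster_series_small.
rewrite (@cluster_sum_rec K c m a N hm ha o s' n cl) cluster_series_rec.
rewrite fcoefD mulrDr fcoefD fcoef_mul_ordered_series //; congr (_ + _).
rewrite fcoef_cst_sub1M mulrCA fcoef_fpsCM; congr (_ * _).
rewrite fcoef_sum mulr_sumr fcoef_sum; apply: eq_big_nat => j jm.
rewrite -addnA (addnC m) addnA (IHk (o + j)%N (o + j + a.-1 :: s')) //=.
- by move: jm; lia.
- by apply: cluster_extend => //; move: jm; lia.
- by move: jm; lia.
Qed.

End Clusters.
End Bivariate.

(** * Inverting the cluster series and comparing coefficients *)

(** The hypotheses give [f] constant coefficient 0 and make [w] the inverse of [1 - f]; cutting the
    geometric series after [n] terms only affects coefficients from index [n] on. *)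
Lemma sum_exprM_eq (R : comUnitRingType) (w f : fps R) n k :
  fcoef w 0 = 1 -> w = 1 + w * f -> (k < n)%N ->
  fcoef (\sum_(i < n) f ^+ i) k = fcoef w k.
Proof.
move=> w0 wf kn.
have f0 : fcoef f 0 = 0.
  move: (congr1 (fun g => fcoef g 0) wf); rewrite fcoefD fcoefM big_ord1 w0 mul1r.
  by rewrite fcoef1 -[LHS]addr0 => /addrI.
have wf1 : w * (1 - f) = 1 by rewrite mulrBr mulr1 {1}wf addrK.
have -> : \sum_(i < n) f ^+ i = w - f ^+ n * w.
  rewrite -[LHS]mul1r -wf1 -mulrA -[1 - f]opprB mulNr -subrX1; ring.
rewrite fcoefD fcoefN fcoefM big1 ?subr0 // => j _.
by rewrite fcoefX_small ?mul0r //; apply: leq_ltn_trans kn; rewrite -ltnS.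
Qed.

Lemma fcoef_hadamard_exp (K : comUnitRingType) (f : fps_xt K) n N :
  fcoef (hadamard_exp f n) N = fcoef f N ^+ n.
Proof.
elim: n => [|n IHn]; last by rewrite exprS -IHn.
have -> : hadamard_exp f 0 = (1 - fpsX (fps K)) ^- 1 := mul1r _.
by rewrite fcoef_sub1X_inv bin0.
Qed.

(** The recursion [word_sumS] as an identity of series: [ordered_series K 0 1] accounts for an
    unmarked first letter, the other term for an initial cluster. *)
Lemma word_series_eq (K : comUnitRingType) (c : K) m a N :
    (5 <= m)%N -> (2 <= a <= m - 2)%N ->
  let W := Fps (word_sum c m a N) in
  W = 1 + W * fcoef (ordered_series K 0 1 + (cst_xt c - 1) * cluster_series c m a 1 m) N.
Proof.
move=> hm ha W; apply: fpsP => n.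
rewrite fcoefD fcoefD mulrDr fcoefD fcoef_mul_ordered_series //.
rewrite fcoef_cst_sub1M mulrCA fcoef_fpsCM.
have := @fcoef_mul_cluster_series K c m a hm ha N 0 [:: a.-1] n (cluster1 a).
rewrite add0n [size _]/= => ->; last lia.
case: n => [|n].
  by rewrite /= word_sum0 cluster_sum_small ?mulr0 ?addr0 //; lia.
rewrite [LHS]/= word_sumS // [fcoef 1 _]/= add0r.
by rewrite addn0 subn0 bin1 subn1.
Qed.

Lemma fcoef_A_ides (K : comUnitRingType) (c : K) m a n N : (0 < a)%N -> (a < m)%N ->
  fcoef (A_ides (swap_pattern m a) n (cst_xt c) var_t / (1 - var_t) ^+ n.+1) N =
  fpsC (word_sum c m a N n).
Proof.
move=> a0 am; case: n => [|n].
  by rewrite /A_ides mul1r fcoef_sub1X_inv bin0 word_sum0.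
rewrite word_sum_perm // [A_ides _ _ _ _](_ : _ = \sum_(p : 'S_n.+1)
  cst_xt c ^+ occ (swap_pattern m a) p * var_t ^+ (ides p).+1) //.
rewrite mulr_suml fcoef_sum [RHS]rmorph_sum.
apply: eq_bigr => p _; rewrite -mulrA -!rmorphXn fcoef_fpsCM fcoef_fpsXnM.
rewrite fcoef_sub1X_inv rmorphM /= rmorph_nat rmorphXn; congr (_ * _).
have := ides_lt p; case: ltnP => pN pn; first by congr (_ *+ _); congr 'C(_, _); lia.
by rewrite bin_small //; lia.
Qed.

Lemma fcoef_fcoef_A_ides (K : comUnitRingType) (c : K) m a n N k :
    (0 < a)%N -> (a < m)%N ->
  fcoef (fcoef (A_ides (swap_pattern m a) n (cst_xt c) var_t /
                  (1 - var_t) ^+ n.+1 * var_x ^+ n) N) k =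
  if n == k then word_sum c m a N n else 0.
Proof.
move=> a0 am; rewrite [_ * var_x ^+ n]mulrC -rmorphXn fcoef_fpsCM fcoef_A_ides //.
rewrite fcoef_fpsXnM /= subn_eq0; case: ltngtP => //.
Qed.

Lemma pattern_series (K : comUnitRingType) (c : K) m a
    (t := var_t : fps_xt K) (x := var_x : fps_xt K) (z := x / (1 - t))
    (s := cst_xt c) :
    (5 <= m)%N -> (2 <= a <= m - 2)%N ->
  exists S : fps_xt K,
    series_sum
      (fun n => A_ides (swap_pattern m a) n s t / (1 - t) ^+ n.+1 * x ^+ n) S /\
    series_sum
      (hadamard_exp
         (t * x / (1 - t) ^+ 2 +
          (s - 1) * t ^+ 2 * z ^+ m /
            ((1 - t) *
               (1 - (s - 1) * t *
                  \sum_(1 <= l < (minn a (m - a)).+1) z ^+ (m - l))))) S.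
Proof.
move=> hm ha; exists (Fps (fun N => Fps (word_sum c m a N))).
(* For the coefficient of [x ^+ k], [k.+1] terms suffice on both sides: on the left only the term of
   index [k] contributes, and on the right the base of the powers has no constant term in [x]. *)
split=> N k; exists k.+1 => n kn.
  rewrite !fcoef_sum (bigD1 (Ordinal kn)) // big1 ?addr0 => [|j jk].
    rewrite fcoef_fcoef_A_ides; [|lia|lia].
    by rewrite /= eqxx addr0.
  rewrite fcoef_fcoef_A_ides; [|lia|lia].
  by rewrite -(inj_eq val_inj) /= in jk; rewrite (negbTE jk).
rewrite fcoef_sum; under eq_bigr do rewrite fcoef_hadamard_exp.
rewrite (_ : t * x / (1 - t) ^+ 2 + _ = ordered_series K 0 1 + (cst_xt c - 1) * cluster_series c m a 1 m).
  rewrite (@sum_exprM_eq _ (Fps (word_sum c m a N)) _ n k) //.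
    exact: word_sum0.
  exact: (word_series_eq c N hm ha).
rewrite /ordered_series /cluster_series -/t -/x -/z -/s; congr (_ + _).
  by rewrite !expr1 exprS expr1 invrM ?unit_sub1t // /z; ring.
by rewrite !mulrA.
Qed.

Theorem theorem5p2 (m a : nat) (hm : (5 <= m)%N) (ha : (2 <= a <= m - 2)%N) :
  let sigma := swap_pattern m a in
  let i := minn a (m - a) in
  (let s : fps_xt {poly int} := cst_xt 'X in
   let t : fps_xt {poly int} := var_t in
   let x : fps_xt {poly int} := var_x in
   let z := x / (1 - t) in
   exists S : fps_xt {poly int},
     series_sum (fun n => A_ides sigma n s t / (1 - t) ^+ n.+1 * x ^+ n) S /\
     series_sum
       (hadamard_exp
          (t * x / (1 - t) ^+ 2 +
           (s - 1) * t ^+ 2 * z ^+ m /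
             ((1 - t) *
                (1 - (s - 1) * t * \sum_(1 <= l < i.+1) z ^+ (m - l))))) S)
  /\
  (let t : fps_xt int := var_t in
   let x : fps_xt int := var_x in
   let z := x / (1 - t) in
   exists S : fps_xt int,
     series_sum (fun n => A_ides sigma n 0 t / (1 - t) ^+ n.+1 * x ^+ n) S /\
     series_sum
       (hadamard_exp
          (t * x / (1 - t) ^+ 2 -
           t ^+ 2 * z ^+ m /
             ((1 - t) * (1 + t * \sum_(1 <= l < i.+1) z ^+ (m - l))))) S).
Proof.
move=> sigma i; split; first exact: pattern_series.
(* The second identity is the specialization [c = 0] over the integers, up to rewriting signs. *)
have := @pattern_series int 0 m a hm ha.
have -> : cst_xt 0 = 0 :> fps_xt int by rewrite /cst_xt !rmorph0.
by rewrite sub0r !mulN1r !mulNr opprK.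
Qed.
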